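(* Let $E$ be a finite nonempty set with $n=|E|$ elements, let $m\ge 2$, and let $\preccurlyeq_1,\dots,\preccurlyeq_m$ be total orderings on $E$, generating the convex geometry $(E,\mathcal C)$. For $x\in E$ let $j_i(x)\in\{1,\dots,n\}$ be the place of $x$ in the $i$-th ordering (so $j_i(x)=1$ for the $\preccurlyeq_i$-smallest element and $x\prec_i y$ iff $j_i(x)<j_i(y)$). Put $v_i=(\cos(2\pi i/m),\sin(2\pi i/m))\in\mathbb R^2$ for $i=1,\dots,m$, and let $\varepsilon$ be a real number with $0<\varepsilon<|\sec(2\pi/m)|-1$ (for $m=4$ the upper bound is read as $+\infty$). For $x\in E$ and $1\le i\le m$ define $$F_i^1(x)=\left(1+\frac{2j_i(x)-1}{2n}\varepsilon\right)v_i,\qquad F_i^2(x)=\left(1+\frac{2j_i(x)}{2n}\varepsilon\right)v_i,$$ and $$P^1(x)=\operatorname{conv}\{F_1^1(x),\dots,F_m^1(x)\},\qquad P^2(x)=\operatorname{conv}\{F_1^2(x),\dots,F_m^2(x)\}.$$ For each $x\in E$ let $K(x)$ be any compact convex set with $P^1(x)\subseteq K(x)\subseteq P^2(x)$, and let $\mathscr K=\{K(x):x\in E\}$. Then $(\mathscr K,\operatorname{conv}_{\mathscr K})$ is a finite convex geometry, and the map $x\mapsto K(x)$ is an isomorphism from the convex geometry $(E,\mathcal C)$ generated by $\{\preccurlyeq_i\}_{i=1}^m$ onto $(\mathscr K,\operatorname{conv}_{\mathscr K})$.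
   Context: A convex geometry on a finite set $E$ is a collection $\mathcal C$ of subsets of $E$ (called convex sets) such that: $\emptyset,E\in\mathcal C$; $X,Y\in\mathcal C$ implies $X\cap Y\in\mathcal C$; and for every $X\in\mathcal C\setminus\{E\}$ there is $e\in E\setminus X$ with $X\cup\{e\}\in\mathcal C$. Equivalently, it is a pair $(E,\Phi)$ where $\Phi:2^E\to 2^E$ is a closure operator with $\Phi(\emptyset)=\emptyset$ satisfying the anti-exchange property: if $A\subseteq E$, $x,y\in E\setminus\Phi(A)$ and $\Phi(A\cup\{x\})=\Phi(A\cup\{y\})$, then $x=y$. The convex sets are the sets $X$ with $\Phi(X)=X$, and $\Phi(X)$ is the intersection of all convex sets containing $X$. Convex geometries $\mathcal C_1$ on $E_1$ and $\mathcal C_2$ on $E_2$ are isomorphic via a bijection $\varphi:E_1\to E_2$ if for all $X\subseteq E_1$: $\varphi(X)\in\mathcal C_2$ iff $X\in\mathcal C_1$. Orderings are total and antisymmetric. The convex geometry generated by orderings $\{\preccurlyeq_i\}_{i=1}^m$ on $E$ is $$\mathcal C=\{\emptyset\}\cup\{X\subseteq E:\ \forall y\notin X\ \exists i\ \forall x\in X,\ x\prec_i y\}.$$ $\operatorname{conv}$ denotes the usual convex hull in $\mathbb R^2$. For a finite family $\mathscr K$ of compact convex sets in $\mathbb R^2$ and $\mathscr S\subseteq\mathscr K$, $$\operatorname{conv}_{\mathscr K}(\mathscr S)=\Big\{K\in\mathscr K:\ K\subseteq\operatorname{conv}\Big(\bigcup_{S\in\mathscr S}S\Big)\Big\}.$$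 *)

(* Defs.v *)
From mathcomp Require Import all_boot all_order all_algebra.
From mathcomp Require Import finmap mathcomp_extra boolp classical_sets functions.
From mathcomp Require Import cardinality reals topology normedtype convex trigo.

Set Implicit Arguments.
Unset Strict Implicit.
Unset Printing Implicit Defensive.

Import Order.TTheory GRing.Theory Num.Theory.
Import numFieldNormedType.Exports.

Local Open Scope classical_set_scope.
Local Open Scope ring_scope.

(* Ground sets are sets [E : set T] over an arbitrary carrier [T], because the
   points of the second geometry are themselves subsets of the plane. *)

Definition convex_geometry (T : Type) (E : set T) (C : set (set T)) : Prop :=
  finite_set E /\
  [/\ forall X, C X -> X `<=` E,
      C set0 /\ C E,
      forall X Y, C X -> C Y -> C (X `&` Y)
    & forall X, C X -> X <> E -> exists e, (E `\` X) e /\ C (X `|` [set e])].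

(* [Phi] is only meaningful on subsets of [E]. *)
Definition closure_operator (T : Type) (E : set T) (Phi : set T -> set T)
    : Prop :=
  [/\ forall A, A `<=` E -> Phi A `<=` E,
      forall A, A `<=` E -> A `<=` Phi A,
      forall A B, A `<=` B -> B `<=` E -> Phi A `<=` Phi B
    & forall A, A `<=` E -> Phi (Phi A) = Phi A].

Definition closure_convex_geometry (T : Type) (E : set T)
    (Phi : set T -> set T) : Prop :=
  [/\ finite_set E,
      closure_operator E Phi,
      Phi set0 = set0
    & forall (A : set T) (x y : T),
        A `<=` E -> (E `\` Phi A) x -> (E `\` Phi A) y ->
        Phi (A `|` [set x]) = Phi (A `|` [set y]) -> x = y].

Definition convex_sets (T : Type) (E : set T) (Phi : set T -> set T)
    : set (set T) :=
  [set X | X `<=` E /\ Phi X = X].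

Definition isomorphic_via (T1 T2 : Type) (E1 : set T1) (C1 : set (set T1))
    (E2 : set T2) (C2 : set (set T2)) (phi : T1 -> T2) : Prop :=
  set_bij E1 E2 phi /\
  forall X, X `<=` E1 -> (C2 (phi @` X) <-> C1 X).

Definition total_ordering (T : eqType) (le : rel T) : Prop :=
  [/\ total le, antisymmetric le & transitive le].

Definition prec (T : eqType) (le : rel T) : rel T :=
  fun x y => (x != y) && le x y.

Definition generated_geometry (E : finType) (m : nat) (le : 'I_m -> rel E)
    : set (set E) :=
  [set X | X = set0 \/
    forall y, ~ X y -> exists i, forall x, X x -> prec (le i) x y].

(* Total orderings are reflexive, so the smallest element has place 1. *)
Definition place (E : finType) (le : rel E) (x : E) : nat :=
  #|[pred y | le y x]|.

Definition convex_hull (R : numDomainType) (M : lmodType R) (A : set M)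
    : set M :=
  smallest (@convex_set R M) A.

Definition conv_in (R : numDomainType) (M : lmodType R) (KK : set (set M))
    (SS : set (set M)) : set (set M) :=
  [set K | KK K /\ K `<=` convex_hull (\bigcup_(S in SS) S)].

(* Since [0^-1 = 0], [sec (pi / 2)] is 0 here instead of infinite; the upper
   bound on [eps] is therefore only meaningful for [m <> 4]. *)
Definition sec (R : realType) (t : R) : R := (cos t)^-1.

(* ['I_m] is {0, ..., m-1}, whereas directions are numbered from 1 to m. *)
Definition dir (R : realType) (m : nat) (i : 'I_m) : 'rV[R]_2 :=
  let t := 2 * pi * i.+1%:R / m%:R in
  \row_(k < 2) (if k == 0 then cos t else sin t).

Definition F1 (R : realType) (E : finType) (m : nat) (le : 'I_m -> rel E)
    (eps : R) (i : 'I_m) (x : E) : 'rV[R]_2 :=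
  (1 + (2 * (place (le i) x)%:R - 1) / (2 * #|E|%:R) * eps) *: dir R i.

Definition F2 (R : realType) (E : finType) (m : nat) (le : 'I_m -> rel E)
    (eps : R) (i : 'I_m) (x : E) : 'rV[R]_2 :=
  (1 + (2 * (place (le i) x)%:R) / (2 * #|E|%:R) * eps) *: dir R i.

Definition P1 (R : realType) (E : finType) (m : nat) (le : 'I_m -> rel E)
    (eps : R) (x : E) : set 'rV[R]_2 :=
  convex_hull (range (fun i => F1 le eps i x)).

Definition P2 (R : realType) (E : finType) (m : nat) (le : 'I_m -> rel E)
    (eps : R) (x : E) : set 'rV[R]_2 :=
  convex_hull (range (fun i => F2 le eps i x)).

Lemma place_mono (E : finType) (le : rel E) (x y : E) :
  total_ordering le -> prec le x y = (place le x < place le y)%N.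
Proof.
move=> [tot anti tr].
have sub a b : prec le a b -> (place le a < place le b)%N.
  move=> /andP[ab leab]; apply/proper_card/properP; split.
    by apply/fintype.subsetP => z; rewrite !inE => /tr; apply.
  exists b; rewrite !inE; first by have := tot b b; rewrite orbb.
  by apply: contra ab => leba; apply/eqP/anti; rewrite leab.
apply/idP/idP; first exact: sub.
move=> lt; have xy : x != y by apply: contraTneq lt => ->; rewrite ltnn.
rewrite /prec xy /=; have /orP[//|leyx] := tot x y.
have : prec le y x by rewrite /prec eq_sym xy.
by move/sub; rewrite ltnNge (ltnW lt).
Qed.

Lemma generated_convex_geometry (E : finType) (m : nat)
    (le : 'I_m -> rel E) :
  (0 < m)%N -> (forall i, total_ordering (le i)) ->
  convex_geometry [set: E] (generated_geometry le).
Proof.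
move=> m0 ord; split; first exact: finite_finset.
have gen0 : generated_geometry le set0 by left.
have genE X : generated_geometry le X ->
    forall y, ~ X y -> exists i, forall x, X x -> prec (le i) x y.
  by move=> [->|//] y _; exists (Ordinal m0).
split => //.
- by split=> //; right=> y /(_ I).
- move=> X Y gX gY; right=> y nXY.
  have [Xy|nXy] := pselect (X y).
    have nYy : ~ Y y by move=> Yy; apply: nXY.
    by have [i hi] := genE _ gY _ nYy; exists i => x [_ /hi].
  by have [i hi] := genE _ gX _ nXy; exists i => x [/hi].
move=> X gX XE.
have [e0 nXe0] : exists e, ~ X e.
  apply: contrapT => h; apply: XE; apply/seteqP; split=> // z _.
  by apply: contrapT => nXz; apply: h; exists z.
pose above i y := `[< forall x, X x -> prec (le i) x y >].
pose pot y := (\sum_(i < m) above i y * place (le i) y)%N.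
have e0P : ~~ `[< X e0 >] by apply/asboolPn.
case: (@arg_minnP _ e0 (fun e => ~~ `[< X e >]) pot e0P) => e /asboolPn nXe emin.
exists e; split; first by split.
right=> y /not_orP[nXy ye].
apply: contrapT => bad.
have le_y i : (above i y -> above i e && (place (le i) y < place (le i) e))%N.
  move=> /asboolP aiy; apply/andP.
  have nlt : ~~ prec (le i) e y.
    by apply/negP => ey; apply: bad; exists i => x [/aiy//|->].
  have lt : (place (le i) y < place (le i) e)%N.
    rewrite -place_mono//; apply/andP; split; first exact/eqP.
    have [/(_ e y)/orP[ley|//] _ _] := ord i.
    by case/negP: nlt; rewrite /prec ley andbT; apply/eqP => /esym.
  split=> //; apply/asboolP => x Xx.
  rewrite place_mono//; apply: ltn_trans lt.
  by rewrite -place_mono//; exact: aiy.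
have [i iy] := genE _ gX _ nXy.
have aiy : above i y by apply/asboolP.
have := emin y (introT (asboolPn _) nXy); apply/negP; rewrite -ltnNge.
rewrite /pot (bigD1 i)//= [ltnRHS](bigD1 i)//=.
have /andP[-> lt] := le_y i aiy; rewrite aiy !mul1n -addSn.
apply: leq_add => //; apply: leq_sum => k _.
have [/le_y/andP[-> /ltnW]|//] := boolP (above k y).
by rewrite !mul1n.
Qed.

Lemma convex_geometry_closure (T : choiceType) (E : set T)
    (Phi : set T -> set T) :
  closure_convex_geometry E Phi -> convex_geometry E (convex_sets E Phi).
Proof.
move=> [finE [PhiE subPhi monPhi idPhi] Phi0 ae]; split=> //; split.
- by move=> X [].
- split; first by split.
  split=> //; apply/seteqP; split; [exact: PhiE|exact: subPhi].
- move=> X Y [XE PX] [YE PY].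
  have XYE : X `&` Y `<=` E by apply: subIset; left.
  split=> //; apply/seteqP; split; last exact: subPhi.
  by rewrite subsetI -{2}PX -{3}PY; split; apply: monPhi.
move=> X [XE PX] nXE.
have finD A : A `<=` E -> finite_set A by move=> /sub_finite_set; apply.
have [e0 De0] : exists e, (E `\` X) e.
  apply: contrapT => h; apply: nXE; apply/seteqP; split=> // z Ez.
  by apply: contrapT => nXz; apply: h; exists z.
have addE e : (E `\` X) e -> X `|` [set e] `<=` E.
  by move=> [Ee _] z [/XE|->].
pose size_of e := #|` fset_set (Phi (X `|` [set e]))|.
have ex : exists k, `[< exists2 e, (E `\` X) e & size_of e = k >].
  by exists (size_of e0); apply/asboolP; exists e0.
case: (ex_minnP ex) => k /asboolP[e De ek] kmin.
exists e; split=> //; split; first exact: addE.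
apply/seteqP; split; last exact/subPhi/addE.
move=> y Py; apply: contrapT => /not_orP[nXy ye].
have Dy : (E `\` X) y by split=> //; exact: (PhiE _ (addE _ De)).
apply: ye; apply: (ae X) => //=; rewrite ?PX//.
have sub : Phi (X `|` [set y]) `<=` Phi (X `|` [set e]).
  rewrite -[X in _ `<=` X]idPhi; last exact: addE.
  apply: monPhi; last exact/PhiE/addE.
  move=> z [Xz|->//]; apply: subPhi; first exact: addE.
  by left.
have fin1 := finD _ (PhiE _ (addE _ Dy)).
have fin2 := finD _ (PhiE _ (addE _ De)).
have eqF : fset_set (Phi (X `|` [set y])) = fset_set (Phi (X `|` [set e])).
  apply/eqP; rewrite eqEfcard; apply/andP; split; first by rewrite -fset_set_sub.
  rewrite -/(size_of e) -/(size_of y) ek.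
  by apply: kmin; apply/asboolP; exists y.
by rewrite -(fset_setK fin1) -(fset_setK fin2) eqF.
Qed.

(* Main.v *)
(* Everything reduces to: K y lies in the hull of the K x, x in S, iff in every
   ordering y is at most some element of S.  If y exceeds all of S in the i-th
   ordering, the half-plane z . v_i < F_i^1(y) . v_i contains every P^2(x),
   x in S: the vertices in direction v_i are shorter, and the other vertices
   project to at most (1 + eps) cos (2 pi / m) < 1, which is the role of the
   bound on eps.  Conversely, if y is outside S, then F_i^2(y) lies between 0
   and F_i^1(x) for some x in S above y in the i-th ordering, and 0 is in P^1(x)
   because the v_i sum to 0.  Hence conv is the image under K of the operator
   [dominated] on E, whose closed sets are the generated geometry. *)
Require Import Defs.
From mathcomp Require Import all_boot all_order all_algebra.
From mathcomp Require Import mathcomp_extra boolp classical_sets functions.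
From mathcomp Require Import cardinality reals topology normedtype convex trigo.
From mathcomp Require Import interval_inference ring lra.

Import Order.TTheory GRing.Theory Num.Theory.
Import numFieldNormedType.Exports.

Local Open Scope classical_set_scope.
Local Open Scope ring_scope.

(** * Transport of closure operators along an injection *)

(** Every subset of [range phi] is an image, and injectivity lets images reflect inclusion and
    equality, so each axiom pulls back to [Phi1]. *)
Lemma closure_geometry_range {T1 T2 : Type} (phi : T1 -> T2)
    (Phi1 : set T1 -> set T1) (Phi2 : set T2 -> set T2) :
  injective phi -> (forall S, Phi2 (phi @` S) = phi @` Phi1 S) ->
  closure_convex_geometry [set: T1] Phi1 ->
  closure_convex_geometry (range phi) Phi2 /\
  isomorphic_via [set: T1] (convex_sets [set: T1] Phi1)
                 (range phi) (convex_sets (range phi) Phi2) phi.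
Proof.
move=> phi_inj Phi2E [fin [_ sub mono idem] Phi10 ae].
have sub_rangeP A : A `<=` range phi -> exists S, A = phi @` S.
  move=> A_sub; exists (phi @^-1` A); apply/seteqP; split=> [z Az|z [x ?] <-//].
  by have [x _ xz] := A_sub z Az; exists x; rewrite /= ?xz.
have image_inj S S' : phi @` S `<=` phi @` S' -> S `<=` S'.
  by move=> SS' x Sx; have [|y S'y /phi_inj <-//] := SS' (phi x); exists x.
have image_eq S S' : phi @` S = phi @` S' -> S = S'.
  by move=> e; apply/seteqP; split; apply: image_inj; rewrite e.
have image1 S x : phi @` S `|` [set phi x] = phi @` (S `|` [set x]).
  by rewrite image_setU image_set1.
split; last split.
- split; [exact: finite_image| split | |].
  + by move=> A /sub_rangeP[S ->]; rewrite Phi2E; apply: image_subset.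
  + by move=> A /sub_rangeP[S ->]; rewrite Phi2E; apply/image_subset/sub.
  + move=> A B AB B_sub; have [S' eB] := sub_rangeP _ B_sub.
    have [S eA] := sub_rangeP _ (subset_trans AB B_sub); move: AB.
    by rewrite eA eB !Phi2E => /image_inj SS'; apply/image_subset/mono.
  + by move=> A /sub_rangeP[S ->]; rewrite !Phi2E idem.
  + by rewrite -(image_set0 phi) Phi2E Phi10.
  + move=> A _ _ /sub_rangeP[S ->] [[x _ <-] nx] [[y _ <-] ny].
    rewrite !image1 !Phi2E => /image_eq e; congr phi.
    apply: (ae S) => //; split=> // h; [apply: nx|apply: ny];
      by rewrite Phi2E; apply: imageP.
- by split=> // x y _ _ /phi_inj.
- move=> X _; rewrite /convex_sets/= Phi2E; split=> [[_ /image_eq]//|[_ ->]].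
  by split=> //; apply: image_subset.
Qed.

(** * Domination in all orderings as a closure operator *)

(** A point is excluded exactly when some ordering places it strictly above all of [S], as in the
    generated geometry. Places are compared because the radii depend on them. *)
Definition dominated {E : finType} {m : nat} (le : 'I_m -> rel E) (S : set E)
    : set E :=
  [set y | forall i, exists2 x, S x & (place (le i) y <= place (le i) x)%N].

Lemma place_inj {E : finType} (le : rel E) :
  total_ordering le -> injective (place le).
Proof.
move=> le_ord x y e; have [tot _ _] := le_ord.
have /negbT nlt : prec le x y = false by rewrite place_mono// e ltnn.
have /negbT nlt' : prec le y x = false by rewrite place_mono// e ltnn.
apply/eqP; apply: contraT => xy; have /orP[h|h] := tot x y.
  by rewrite /prec xy h in nlt.
by rewrite /prec eq_sym xy h in nlt'.
Qed.

Lemma closure_geometry_dominated {E : finType} {m : nat} (le : 'I_m -> rel E) :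
  (0 < m)%N -> (forall i, total_ordering (le i)) ->
  closure_convex_geometry [set: E] (dominated le).
Proof.
move=> m0 le_ord; have sub S : S `<=` dominated le S by move=> x Sx i; exists x.
have notdom S y : ~ dominated le S y ->
    exists i, forall x, S x -> (place (le i) x < place (le i) y)%N.
  move=> /existsNP[i] h; exists i => x Sx; rewrite ltnNge; apply/negP => yx.
  by apply: h; exists x.
split; [exact: finite_finset|split => // | |].
- by move=> A B AB _ y Ay i; have [x /AB Bx yx] := Ay i; exists x.
- move=> A _; apply/seteqP; split; last exact: sub.
  move=> z Az i; have [y /(_ i)[x Ax yx] zy] := Az i.
  by exists x => //; apply: leq_trans yx.
- by rewrite -subset0 => y /(_ (Ordinal m0))[].
(* Anti-exchange: fix an ordering [i] with [x] above all of [A]. Only [y] can then dominate [x], and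
   whatever dominates [y] is at most [x], so both have the same place. *)
- move=> A x y _ [_ /notdom[i iA]] _ e.
  have xy : (place (le i) x <= place (le i) y)%N.
    have : dominated le (A `|` [set y]) x by rewrite -e; apply: sub; right.
    by move=> /(_ i)[z [Az|->//]]; rewrite leqNgt iA.
  have yx : (place (le i) y <= place (le i) x)%N.
    have : dominated le (A `|` [set x]) y by rewrite e; apply: sub; right.
    by move=> /(_ i)[z [Az yz|->//]]; apply: leq_trans yz (ltnW (iA _ Az)).
  by apply: (place_inj (le i)) => //; apply/eqP; rewrite eqn_leq xy.
Qed.

Lemma convex_sets_dominated {E : finType} {m : nat} (le : 'I_m -> rel E) :
  (0 < m)%N -> (forall i, total_ordering (le i)) ->
  convex_sets [set: E] (dominated le) = generated_geometry le.
Proof.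
move=> m0 le_ord; apply/seteqP; split=> X.
  move=> [_ XE]; right=> y; rewrite -{1}XE => /existsNP[i yi]; exists i => x Xx.
  by rewrite place_mono// ltnNge; apply/negP => yx; apply: yi; exists x.
move=> gX; split=> //; apply/seteqP; split=> y; last by move=> Xy i; exists y.
move=> Xy; apply: contrapT => nXy; case: gX => [X0|/(_ _ nXy)[i iy]].
  by have [x] := Xy (Ordinal m0); rewrite X0.
have [x Xx] := Xy i; rewrite leqNgt -place_mono//; apply/negP/negPn.
exact: iy.
Qed.

(** * Convex hulls and convex combinations *)

Lemma convex_convex_hull {R : numDomainType} {M : lmodType R} (A : set M) :
  convex_set (convex_hull A).
Proof.
move=> x y t /set_mem hx /set_mem hy; apply/mem_set => B [cB AB].
by apply/set_mem/cB; apply/mem_set; [exact: hx|exact: hy].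
Qed.

(** Trades the interval-typed weight of [convex_set] for a scalar with two bounds. *)
Lemma convex_setP {R : numDomainType} {M : lmodType R} (A : set M) :
  convex_set A -> forall (x y : M) (t : R), A x -> A y -> 0 <= t -> t <= 1 ->
  A (t *: x + (1 - t) *: y).
Proof.
move=> cA x y t Ax Ay t0 t1.
have t01 : Itv.spec (@Itv.num_sem R) (Itv.Real `[0%Z, 1%Z]) t.
  by rewrite /= /Itv.num_sem /= ger0_real //= in_itv /= t0 t1.
exact: (set_mem (cA x y (Itv.mk t01) (mem_set Ax) (mem_set Ay))).
Qed.

(** The point [q] is the weighted mean; leaving the weights unnormalised spares the induction a
    rescaling. *)
Lemma convex_set_sum {R : numFieldType} {M : lmodType R} (A : set M)
    (n : nat) (w : 'I_n -> R) (p : 'I_n -> M) :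
  convex_set A -> (0 < n)%N -> (forall i, 0 < w i) -> (forall i, A (p i)) ->
  exists2 q, A q & \sum_(i < n) w i *: p i = (\sum_(i < n) w i) *: q.
Proof.
move=> cA; elim: n w p => [//|[|n] IH] w p _ w0 Ap.
  by exists (p ord0); rewrite ?big_ord1.
have [//|i|i|q Aq sumE] := IH (w \o lift ord0) (p \o lift ord0).
- exact: w0.
- exact: Ap.
rewrite !(big_ord_recl n.+1) /= in sumE *; rewrite sumE.
set W := \sum_(i < n.+1) _.
have W0 : 0 <= W by apply: sumr_ge0 => i _; apply: ltW.
have wW : 0 < w ord0 + W by rewrite ltr_wpDr.
exists (w ord0 / (w ord0 + W) *: p ord0 + (1 - w ord0 / (w ord0 + W)) *: q).
  apply: convex_setP => //; first by rewrite divr_ge0 ?ltW.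
  by rewrite ler_pdivrMr// mul1r lerDl.
rewrite scalerDr !scalerA mulrBr mulr1 mulrCA divff ?gt_eqF// mulr1.
by rewrite addrAC subrr add0r.
Qed.

(** * Half-planes and the directions [dir] *)

(** The inequality is strict so that a vertex on the bounding line is separated from the hull. *)
Lemma convex_halfspace {R : numDomainType} {n : nat} (v : 'rV[R]_n) (c : R) :
  convex_set [set z : 'rV[R]_n | (z *m v^T) 0 0 < c].
Proof.
apply/convex_setW => x y /set_mem/= hx /set_mem/= hy t t0 t1.
apply/mem_set => /=.
rewrite /conv/= mulmxDl -!scalemxAl mxE [X in X + _]mxE [X in _ + X]mxE.
have -> : c = t%:num * c + (1 - t%:num) * c by rewrite mulrBl mul1r addrC subrK.
by apply: ltrD; rewrite ltr_pM2l// subr_gt0.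
Qed.

(* The sum times 2 sin (pi / m) telescopes. *)
Lemma sum_cos_roots {R : realType} (m : nat) (phi : R) : (1 < m)%N ->
  \sum_(i < m) cos (2 * pi * i.+1%:R / m%:R - phi) = 0.
Proof.
move=> m1; have m0 : 0 < m%:R :> R by rewrite ltr0n; case: m m1.
set h : R := pi / m%:R.
have h_gt0 : 0 < h by rewrite divr_gt0 ?pi_gt0.
have sin_neq0 : 2 * sin h != 0.
  rewrite mulf_neq0 ?pnatr_eq0// gt_eqF// sin_gt0_pi// h_gt0 /=.
  by rewrite ltr_pdivrMr// ltr_pMr ?pi_gt0// ltr1n.
apply: (mulfI sin_neq0); rewrite mulr0 mulr_sumr.
(* Consecutive angles differ by 2 h and 2 sin h cos t = sin (t + h) - sin (t - h); [f m] and [f 0]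
   differ by a full turn. *)
pose f k := sin (2 * pi * k%:R / m%:R - phi + h).
rewrite (eq_bigr (fun i : 'I_m => f i.+1 - f i)) => [|i _].
  rewrite -(big_mkord xpredT (fun i => f i.+1 - f i)) telescope_sumr//.
  rewrite /f mulfK ?gt_eqF// mulr0 mul0r sub0r -addrA addrC mulr_natl.
  by rewrite sinD2pi subrr.
rewrite /f; set t := 2 * pi * i.+1%:R / m%:R - phi.
have -> : 2 * pi * i%:R / m%:R - phi + h = t - h.
  by rewrite /t /h -natr1; field; rewrite gt_eqF.
by rewrite sinB sinD; ring.
Qed.

Lemma sum_dir {R : realType} (m : nat) : (1 < m)%N ->
  \sum_(i < m) dir R i = 0.
Proof.
move=> m1; apply/rowP => k; rewrite summxE mxE.
(* The phase pi / 2 turns the cosines into the sines of the second coordinate. *)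
rewrite -[RHS](sum_cos_roots m (if k == 0 then 0 else pi / 2) m1).
apply: eq_bigr => i _; rewrite mxE.
by case: ifP => _; rewrite ?subr0 ?cosBpihalf.
Qed.

(** The reflection t -> 2 pi - t reduces to t <= pi, where the cosine decreases. *)
Lemma cos_circle_le {R : realType} (a t : R) : 0 <= a ->
  a <= t -> t <= 2 * pi - a -> cos t <= cos a.
Proof.
move=> a0 at_ ta.
wlog t_pi : t at_ ta / t <= pi.
  move=> wl; have [/wl->//|pi_t] := leP t pi.
  have -> : cos t = cos (2 * pi - t).
    by rewrite mulr_natl addrC cosD2pi cosN.
  by apply: wl; lra.
have [<-//|neq] := eqVneq a t.
rewrite ltW// ltr_cos ?in_itv/= ?a0 ?(le_trans at_)//.
  by rewrite lt_neqAle neq.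
by rewrite t_pi (le_trans a0).
Qed.

Lemma dir_dot {R : realType} (m : nat) (i k : 'I_m) :
  (dir R k *m (dir R i)^T) 0 0
  = cos (2 * pi * k.+1%:R / m%:R - 2 * pi * i.+1%:R / m%:R).
Proof. by rewrite mxE !big_ord_recl big_ord0 !mxE /= addr0 cosB. Qed.

(** For i < k the angle is d (2 pi / m) with 1 <= d <= m - 1, so it stays at least 2 pi / m away
    from 0 and from a full turn. *)
Lemma dir_dot_neq {R : realType} (m : nat) (i k : 'I_m) : k != i ->
  (dir R k *m (dir R i)^T) 0 0 <= cos (2 * pi / m%:R).
Proof.
rewrite dir_dot; wlog lt_ik : i k / (i < k)%N.
  move=> wl; rewrite neq_ltn => /orP[ki|ik]; last first.
    by apply: wl => //; rewrite neq_ltn ik orbT.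
  by rewrite -cosN opprB; apply: wl => //; rewrite neq_ltn ki orbT.
move=> _; have m0 : 0 < m%:R :> R.
  by rewrite ltr0n (leq_ltn_trans _ (ltn_ord i)).
have pi0 := pi_gt0 R.
have a0 : 0 < 2 * pi / m%:R :> R by rewrite divr_gt0 ?mulr_gt0.
rewrite -mulrBl -mulrBr mulrAC.
have e : k.+1%:R - i.+1%:R = (k - i)%:R :> R by rewrite -natrB ?subSS// ltnW.
have d1 : 1 <= (k - i)%:R :> R by rewrite ler1n subn_gt0.
have d2 : (k - i)%:R <= m%:R - 1 :> R.
  rewrite lerBrDr natr1 ler_nat.
  exact: leq_ltn_trans (leq_subr _ _) (ltn_ord k).
rewrite e; apply: cos_circle_le; first exact: ltW.
  by rewrite ler_peMr// ltW.
have -> : 2 * pi - 2 * pi / m%:R = 2 * pi / m%:R * (m%:R - 1) :> R.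
  by field; rewrite gt_eqF.
by rewrite ler_pM2l.
Qed.

(** * Radii of the vertices and the bound on [eps] *)

Lemma place_gt0 {E : finType} (le : rel E) (x : E) :
  total_ordering le -> (0 < place le x)%N.
Proof.
move=> [tot _ _]; apply/card_gt0P; exists x.
by have := tot x x; rewrite inE orbb.
Qed.

Lemma F1_dot {R : realType} {E : finType} {m : nat} (le : 'I_m -> rel E)
    (eps : R) (i : 'I_m) (x : E) :
  (F1 le eps i x *m (dir R i)^T) 0 0
  = 1 + (2 * (place (le i) x)%:R - 1) / (2 * #|E|%:R) * eps.
Proof. by rewrite -scalemxAl mxE dir_dot subrr cos0 mulr1. Qed.

(** The form in which the bound on [eps] is used; a vanishing cosine, as for m = 4, makes the
    product 0. *)
Lemma sec_bound {R : realType} (eps t : R) :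
  0 < eps -> (cos t != 0 -> eps < `|sec t| - 1) -> (1 + eps) * cos t < 1.
Proof.
move=> eps0; have [-> _|c0 /(_ isT)] := eqVneq (cos t) 0.
  by rewrite mulr0.
rewrite ltrBrDl /sec normfV => lt_sec; apply: le_lt_trans (ler_norm _) _.
have eps1 : 0 < 1 + eps by rewrite addr_gt0.
by rewrite normrM gtr0_norm// -ltr_pdivlMr ?normr_gt0// div1r.
Qed.

Section radii.
Context {R : realType} {E : finType} {m : nat} (le : 'I_m -> rel E) (eps : R).
Hypotheses (E_nonempty : (0 < #|E|)%N) (m_ge2 : (2 <= m)%N).
Hypothesis le_ordering : forall i, total_ordering (le i).
Hypothesis eps_gt0 : 0 < eps.

Let card_gt0 : 0 < 2 * #|E|%:R :> R.
Proof. by rewrite mulr_gt0// ltr0n. Qed.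

Let F1_radius_gt1 i x :
  1 < 1 + (2 * (place (le i) x)%:R - 1) / (2 * #|E|%:R) * eps.
Proof.
rewrite ltrDl mulr_gt0// divr_gt0//.
(* Places start at 1, so 2 j - 1 is positive. *)
have : 1 <= (place (le i) x)%:R :> R by rewrite ler1n place_gt0.
lra.
Qed.

Lemma origin_in_P1 x : P1 le eps x 0.
Proof.
(* Weights reciprocal to the radii turn the vertices back into the [dir R i], whose sum is 0; the
   total weight being positive, the mean [q] is 0. *)
pose w i : R := (1 + (2 * (place (le i) x)%:R - 1) / (2 * #|E|%:R) * eps)^-1.
have w_gt0 i : 0 < w i by rewrite invr_gt0 (lt_trans ltr01).
have FP i : P1 le eps x (F1 le eps i x).
  by apply: sub_gen_smallest; exists i.
have [|q Pq] := convex_set_sum _ m w _ (convex_convex_hull _) _ w_gt0 FP.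
  exact: ltnW.
rewrite (eq_bigr (@dir R m)) => [|i _]; last first.
  by rewrite scalerA mulVf ?scale1r// gt_eqF// (lt_trans ltr01).
rewrite sum_dir// => /esym/eqP; rewrite scaler_eq0 gt_eqF/=.
  by move/eqP <-.
by rewrite (bigD1 (Ordinal m_ge2))//= ltr_wpDr// sumr_ge0// => k _; apply: ltW.
Qed.

(** Places are integers, so j(y) < j(x) gives 2 j(y) < 2 j(x) - 1: the outer radius of [y] is below
    the inner radius of [x]. *)
Lemma F2_segment i x y : (place (le i) y < place (le i) x)%N ->
  exists t : R, [/\ 0 <= t, t <= 1 & F2 le eps i y = t *: F1 le eps i x].
Proof.
move=> yx; set r1 := 1 + (2 * (place (le i) x)%:R - 1) / (2 * #|E|%:R) * eps.
set r2 := 1 + (2 * (place (le i) y)%:R) / (2 * #|E|%:R) * eps.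
have r1_gt0 : 0 < r1 by exact: lt_trans ltr01 (F1_radius_gt1 i x).
have r2_ge0 : 0 <= r2.
  by rewrite addr_ge0// mulr_ge0 ?(ltW eps_gt0)// divr_ge0
    ?(ltW card_gt0)// mulr_ge0.
have r21 : r2 <= r1.
  rewrite lerD2l ler_pM2r// ler_pM2r ?invr_gt0//.
  have : (place (le i) y)%:R + 1 <= (place (le i) x)%:R :> R.
    by rewrite natr1 ler_nat.
  lra.
exists (r2 / r1); split; first by rewrite divr_ge0// ltW.
  by rewrite ler_pdivrMr// mul1r.
by rewrite /F1 /F2 scalerA -/r1 -/r2 divfK// gt_eqF.
Qed.

Hypothesis eps_cos : (1 + eps) * cos (2 * pi / m%:R) < 1.

Lemma P2_halfspace i x y : (place (le i) x < place (le i) y)%N ->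
  P2 le eps x `<=`
  [set z | (z *m (dir R i)^T) 0 0 < (F1 le eps i y *m (dir R i)^T) 0 0].
Proof.
move=> xy; apply: smallest_sub; first exact: convex_halfspace.
move=> _ [k _ <-] /=; rewrite F1_dot /F2 -scalemxAl mxE.
have [->|ki] := eqVneq k i.
  rewrite dir_dot subrr cos0 mulr1 ltrD2l ltr_pM2r// ltr_pM2r ?invr_gt0//.
  have : (place (le i) x)%:R + 1 <= (place (le i) y)%:R :> R.
    by rewrite natr1 ler_nat.
  lra.
(* For a vertex in another direction it suffices to project below 1. *)
apply: lt_trans (F1_radius_gt1 i y).
set r := 1 + _; have r_gt1 : 1 <= r.
  by rewrite lerDl mulr_ge0 ?(ltW eps_gt0)// divr_ge0
    ?(ltW card_gt0)// mulr_ge0.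
have r_le : r <= 1 + eps.
  rewrite lerD2l ler_piMl ?(ltW eps_gt0)// ler_pdivrMr// mul1r ler_pM2l//.
  rewrite ler_nat.
  exact: max_card.
have d_le := @dir_dot_neq R m i k ki.
set d : R := fun_of_matrix _ _ _ in d_le *.
have r_ge0 : 0 <= r by apply: le_trans r_gt1.
(* The bounds on [r] and [d] can be multiplied only when [d] is nonnegative; otherwise the product
   is at most 0. *)
have [d0|/ltW d0] := leP d 0; first exact:
  le_lt_trans (mulr_ge0_le0 r_ge0 d0) ltr01.
by apply: le_lt_trans eps_cos; apply: ler_pM.
Qed.

(** * Hull containment as domination *)

Variable K : E -> set 'rV[R]_2.
Hypothesis P1_sub_K : forall x, P1 le eps x `<=` K x.
Hypothesis K_sub_P2 : forall x, K x `<=` P2 le eps x.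

Lemma sub_hull_dominated (S : set E) y :
  K y `<=` convex_hull (\bigcup_(T in K @` S) T) <-> dominated le S y.
Proof.
rewrite bigcup_image; split=> [sub i|dom].
  apply: contrapT => h.
  have lt_y x : S x -> (place (le i) x < place (le i) y)%N.
    by move=> Sx; rewrite ltnNge; apply/negP => yx; apply: h; exists x.
  have : convex_hull (\bigcup_(x in S) K x) (F1 le eps i y).
    by apply: sub; apply: P1_sub_K; apply: sub_gen_smallest; exists i.
  have sub_half : \bigcup_(x in S) K x `<=`
      [set z | (z *m (dir R i)^T) 0 0 < (F1 le eps i y *m (dir R i)^T) 0 0].
    move=> z [x /lt_y xy Kz]; apply: (P2_halfspace i x y xy).
    exact: K_sub_P2.
  by move/(smallest_sub (convex_halfspace _ _) sub_half); rewrite /= ltxx.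
(* Points of [S] are treated apart because [F2] exceeds [F1] at the same point; outside [S],
   injectivity of places makes the domination strict. *)
have [Sy|nSy] := pselect (S y).
  by move=> z Kz; apply: sub_gen_smallest; exists y.
apply: subset_trans (@K_sub_P2 y) _.
apply: smallest_sub; first exact: convex_convex_hull.
have hull x z : S x -> P1 le eps x z -> convex_hull (\bigcup_(x in S) K x) z.
  by move=> Sx /P1_sub_K Kz; apply: sub_gen_smallest; exists x.
move=> _ [i _ <-]; have [x Sx] := dom i.
rewrite leq_eqVlt => /orP[/eqP/(place_inj _ (le_ordering i)) yx|].
  by rewrite yx in nSy.
move=> /F2_segment[t [t0 t1 ->]].
(* The shortened vertex is a convex combination of the vertex and the origin. *)
rewrite -[_ *: _]addr0 -(scaler0 _ (1 - t)).
apply: convex_setP => //; first exact: convex_convex_hull.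
  by apply: (hull x) => //; apply: sub_gen_smallest; exists i.
by apply: (hull x) => //; apply: origin_in_P1.
Qed.

(** Equal bodies dominate each other as singletons, so their places agree in every ordering, and one
    ordering already separates points. *)
Lemma K_inj : injective K.
Proof.
have sub x y : K x = K y -> forall i, (place (le i) x <= place (le i) y)%N.
  move=> e; have [+ _] := sub_hull_dominated [set y] x.
  move=> /(_ _) dom i; have [|_ -> //] := dom _ i.
  by rewrite e => z Kz; apply: sub_gen_smallest; exists (K y) => //; exists y.
move=> x y e; pose i := Ordinal m_ge2.
by apply: (place_inj (le i)) => //; apply/eqP; rewrite eqn_leq !sub.
Qed.

Lemma conv_in_dominated (S : set E) :
  conv_in (range K) (K @` S) = K @` dominated le S.
Proof.
apply/seteqP; split=> [_ [[y _ <-] /sub_hull_dominated dom]|_ [y dom <-]].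
  by exists y.
by split; [exists y|apply/sub_hull_dominated].
Qed.

End radii.

Theorem theorem3p1 (R : realType) (E : finType) (m : nat)
    (le : 'I_m -> rel E) (eps : R) (K : E -> set 'rV[R]_2)
    (E_nonempty : (0 < #|E|)%N)
    (m_ge2 : (2 <= m)%N)
    (le_ordering : forall i, total_ordering (le i))
    (eps_gt0 : 0 < eps)
    (eps_lt : m <> 4%N -> eps < `|sec (2 * pi / m%:R)| - 1)
    (K_compact : forall x, compact (K x))
    (K_convex : forall x, convex_set (K x))
    (P1_sub_K : forall x, P1 le eps x `<=` K x)
    (K_sub_P2 : forall x, K x `<=` P2 le eps x) :
  let KK := range K in
  closure_convex_geometry KK (conv_in KK) /\
  isomorphic_via [set: E] (generated_geometry le)
                 KK (convex_sets KK (conv_in KK)) K.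
Proof.
move=> KK; have m_gt0 : (0 < m)%N by apply: ltnW.
have eps_cos : (1 + eps) * cos (2 * pi / m%:R) < 1.
  (* For m = 4 the angle is pi / 2, so a nonzero cosine excludes that case and gives access to the
     bound. *)
  apply: sec_bound => // c0; apply: eps_lt => m4; move: c0.
  have -> : 2 * pi / m%:R = pi / 2 :> R by rewrite m4; field.
  by rewrite cos_pihalf eqxx.
rewrite -(convex_sets_dominated le m_gt0 le_ordering).
apply: closure_geometry_range.
- exact: (K_inj le eps).
- exact: (conv_in_dominated le eps).
- exact: closure_geometry_dominated.
Qed.
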